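(* Let $V=\mathbb{C}[\partial]v$ be a free $\mathbb{C}[\partial]$-module of rank one, and suppose $V$ is a non-trivial generalized conformal module over the Virasoro conformal algebra $Vir=\mathbb{C}[\partial]L$. Then the action must be of the form $$L_\lambda v=e^{q(\lambda+\partial)-q(\partial)}(\partial+a\lambda+b)v$$ for some $a,b\in\mathbb{C}$ and $q(\partial)\in\mathbb{C}[\partial]$. Denote the module with this action by $M_{q(\partial),a,b}$. Moreover, $M_{q(\partial),a,b}$ is irreducible if and only if $a\neq0$.
   Context: The Virasoro conformal algebra is $Vir=\mathbb{C}[\partial]L$, free of rank one over $\mathbb{C}[\partial]$, with $\lambda$-bracket determined by $[L_\lambda L]=(\partial+2\lambda)L$. A generalized conformal module $V$ over $Vir$ is a $\mathbb{C}[\partial]$-module with a linear map $L_\lambda:V\to V[[\lambda]]$ such that $L_\lambda(\partial v)=(\partial+\lambda)L_\lambda v$ and $L_\lambda(L_\mu v)-L_\mu(L_\lambda v)=(\lambda-\mu)L_{\lambda+\mu}v$ in $V[[\lambda,\mu]]$ for all $v\in V$ (here $L_\lambda$ is extended coefficientwise to power series). It is non-trivial if $L_\lambda\ne0$ on $V$. A submodule is a $\mathbb{C}[\partial]$-submodule $W$ with $L_\lambda W\subseteq W[[\lambda]]$; $V$ is irreducible if $V\neq0$ and its only submodules are $0$ and $V$. $e^{q(\lambda+\partial)-q(\partial)}=\sum_{k\ge0}\frac{(q(\lambda+\partial)-q(\partial))^k}{k!}\in\mathbb{C}[\partial][[\lambda]]$. *)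

(* Defs.v *)
From HB Require Import structures.
From mathcomp Require Import all_boot all_order all_algebra.
From mathcomp Require Import reals.
From mathcomp Require Import complex.

Set Implicit Arguments.
Unset Strict Implicit.
Unset Printing Implicit Defensive.

Import GRing.Theory.
Local Open Scope ring_scope.

(* A [{poly F}]-module is a module over F[∂], with ∂ acting as ['X *: _] and a
   scalar c of F acting as [c%:P *: _].  The power series Σ_n f_n λ^n of V[[λ]]
   is its coefficient function [f : nat -> V], and Σ_{m,n} g_{m,n} λ^m μ^n of
   V[[λ,μ]] is [g : nat -> nat -> V], with the exponent of λ first. *)

Definition mul_lambda (V : zmodType) (f : nat -> V) (n : nat) : V :=
  if n is n'.+1 then f n' else 0.

Definition mul_lambda2 (V : zmodType) (g : nat -> nat -> V) (m n : nat) : V :=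
  if m is m'.+1 then g m' n else 0.

Definition mul_mu2 (V : zmodType) (g : nat -> nat -> V) (m n : nat) : V :=
  if n is n'.+1 then g m n' else 0.

(* f(λ+μ), by the binomial theorem *)
Definition at_lambda_plus_mu (V : zmodType) (f : nat -> V) (m n : nat) : V :=
  f (m + n)%N *+ 'C(m + n, m).

Section GeneralizedConformalModule.

Variables (F : fieldType) (V : lmodType {poly F}).

(* [L u n] is the coefficient of λ^n in L_λ u.  Hence [L (L u n) m] is the
   coefficient of λ^m μ^n in L_λ(L_μ u), and [L (L u m) n] is the one in
   L_μ(L_λ u). *)
Record gen_conformal_module (L : V -> nat -> V) : Prop := GenConformalModule {
  gcm_linear : forall (c : F) (u w : V) (n : nat),
    L (c%:P *: u + w) n = c%:P *: L u n + L w n;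
  gcm_sesquilinear : forall (u : V) (n : nat),
    L ('X *: u) n = 'X *: L u n + mul_lambda (L u) n;
  gcm_commutator : forall (u : V) (m n : nat),
    L (L u n) m - L (L u m) n
    = mul_lambda2 (at_lambda_plus_mu (L u)) m n
      - mul_mu2 (at_lambda_plus_mu (L u)) m n
}.

Definition nontrivial_action (L : V -> nat -> V) : Prop :=
  exists (u : V) (n : nat), L u n <> 0.

Record conformal_submodule (L : V -> nat -> V) (W : V -> Prop) : Prop :=
  ConformalSubmodule {
  csub_0 : W 0;
  csub_linear : forall (p : {poly F}) (u w : V), W u -> W w -> W (p *: u + w);
  csub_action : forall (u : V) (n : nat), W u -> W (L u n)
}.

Definition conformal_irreducible (L : V -> nat -> V) : Prop :=
  (exists u : V, u <> 0) /\
  (forall W : V -> Prop, conformal_submodule L W ->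
     (forall u : V, W u <-> u = 0) \/ (forall u : V, W u)).

Definition free_on (v : V) : Prop :=
  forall u : V, exists! p : {poly F}, u = p *: v.

End GeneralizedConformalModule.

Section RankOneAction.

Variable F : fieldType.

(* In [{poly {poly F}}] the outer variable ['X] is λ and the inner one,
   embedded as ['X%:P], is ∂. *)
Definition shift_diff (q : {poly F}) : {poly {poly F}} :=
  q^:P \Po ('X + 'X%:P) - q%:P.

Definition exp_term (p : {poly {poly F}}) (k n : nat) : {poly F} :=
  ((k`!)%:R^-1 : F) *: (p ^+ k)`_n.

(* Coefficient of λ^n in exp p = Σ_k p^k / k!, for p without constant term in
   λ: the terms with k > n do not contribute, see [exp_coefE]. *)
Definition exp_coef (p : {poly {poly F}}) (n : nat) : {poly F} :=
  \sum_(k < n.+1) exp_term p k n.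

Lemma coef_expr_eq0 (p : {poly {poly F}}) (k n : nat) :
  p`_0 = 0 -> (n < k)%N -> (p ^+ k)`_n = 0.
Proof.
move=> p0; elim: k n => [|k IHk] n ltnk //.
rewrite exprS coefM big_ord_recl p0 mul0r add0r big1 // => i _.
rewrite IHk ?mulr0 //= /bump /= add1n.
by case: n ltnk i => [|n] ltnk i; [case: i | rewrite subSS (leq_ltn_trans (leq_subr _ _))].
Qed.

Lemma exp_coefE (p : {poly {poly F}}) (n N : nat) :
  p`_0 = 0 -> (n < N)%N -> \sum_(k < N) exp_term p k n = exp_coef p n.
Proof.
move=> p0 /subnKC <-; rewrite big_split_ord /= [X in _ + X]big1 ?addr0 // => i _.
by rewrite /exp_term coef_expr_eq0 ?scaler0 // ltn_addr.
Qed.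

Lemma shift_diff_coef0 (q : {poly F}) : (shift_diff q)`_0 = 0.
Proof.
rewrite /shift_diff coefB coefC /= -horner_coef0 horner_comp !hornerE.
by rewrite -/(comp_poly 'X q) comp_polyXr subrr.
Qed.

(* Coefficient of λ^n in e^{q(λ+∂)-q(∂)} (∂ + aλ + b). *)
Definition rank_one_coef (q : {poly F}) (a b : F) (n : nat) : {poly F} :=
  \sum_(i < n.+1)
    exp_coef (shift_diff q) i * (('X%:P + a%:P%:P * 'X + b%:P%:P)`_(n - i)).

(* [L] is the action of M_{q,a,b} on V = F[∂]v. *)
Definition is_M (V : lmodType {poly F}) (v : V) (q : {poly F}) (a b : F)
    (L : V -> nat -> V) : Prop :=
  gen_conformal_module L /\ (forall n : nat, L v n = rank_one_coef q a b n *: v).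

End RankOneAction.

(* Main.v *)
(* Put D = d/d∂ + q'(∂).  Since e^{λD} = e^{-q} e^{λ d/d∂} e^q, the action of
   M_{q,a,b} on F[∂]v is L_λ = (∂ + b + aλ) e^{λD}, and the module axioms follow
   from D∂ - ∂D = 1.

   Conversely, put L_λ v = Σ f_n λ^n v.  The λ^1 μ^0 part of the commutator identity
   reads f_0' f_0 = f_0, so f_0 = 0, which forces L = 0, or f_0 = ∂ + b.  In the
   latter case the λ^m μ^1 part determines (∂ + b) f_m' + (m - 1) f_m, hence f_m for
   m > 1, by f_0, ..., f_{m-1}; and every f_1 is of the form q'(∂)(∂ + b) + a, as in
   M_{q,a,b}.

   If p(∂)v lies in a submodule, multiplying L_λ(p v) by e^{q(∂)-q(λ+∂)} shows that
   so do the λ-coefficients of p(λ+∂)(∂ + aλ + b)v, the last of which is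
   a lead_coef(p) v if a ≠ 0.  If a = 0, then (∂ + b)v generates a proper submodule. *)

Require Import Defs.
From mathcomp Require Import all_boot all_order all_algebra.
From mathcomp Require Import boolp reals.
From mathcomp Require Import complex.
From HB Require Import structures.
From mathcomp Require Import ring.

Set Implicit Arguments.
Unset Strict Implicit.
Unset Printing Implicit Defensive.

Import GRing.Theory.
Local Open Scope ring_scope.

(** * Coefficients of f(λ+μ) *)

Section PowerSeries.

Variable V : zmodType.

(** Pascal's rule: under the substitution the factor λ becomes λ+μ. *)
Lemma at_lambda_plus_mu_mul_lambda (f : nat -> V) (m n : nat) :
  at_lambda_plus_mu (mul_lambda f) m n
  = mul_lambda2 (at_lambda_plus_mu f) m n + mul_mu2 (at_lambda_plus_mu f) m n.
Proof.
rewrite /at_lambda_plus_mu; case: m n => [|m] [|n] /=.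
- by rewrite mul0rn addr0.
- by rewrite add0r !bin0.
- by rewrite !addn0 !binn addr0.
by rewrite addSn /= -addSnnS binS mulrnDr addrC.
Qed.

Lemma at_lambda_plus_muC (f : nat -> V) (m n : nat) :
  at_lambda_plus_mu f m n = at_lambda_plus_mu f n m.
Proof. by rewrite /at_lambda_plus_mu -bin_sub ?leq_addr // addKn addnC. Qed.

End PowerSeries.

(** * The operators e^{λD} and the module axioms for (∂+b+aλ) e^{λD} *)

Section TwistedDerivation.

Variable F : fieldType.
Implicit Types p q r : {poly F}.

Definition twisted_deriv q p := p^`() + q^`() * p.

(* Coefficient of λ^n in e^{λD} p, where D = d/d∂ + q'(∂). *)
Definition twisted_shift q n p := (n`!%:R^-1 : F) *: iter n (twisted_deriv q) p.

Lemma twisted_deriv_is_linear q : linear (twisted_deriv q).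
Proof. by move=> c p r; rewrite /twisted_deriv !derivE -!mul_polyC; ring. Qed.

HB.instance Definition _ q := GRing.isLinear.Build F {poly F} {poly F} *:%R
  (twisted_deriv q) (twisted_deriv_is_linear q).

Lemma twisted_shift_is_linear q n : linear (twisted_shift q n).
Proof.
move=> c p r; rewrite /twisted_shift.
suff -> : iter n (twisted_deriv q) (c *: p + r)
    = c *: iter n (twisted_deriv q) p + iter n (twisted_deriv q) r.
  by rewrite scalerDr !scalerA mulrC.
by elim: n => //= n ->; rewrite linearP.
Qed.

HB.instance Definition _ q n := GRing.isLinear.Build F {poly F} {poly F} *:%R
  (twisted_shift q n) (twisted_shift_is_linear q n).

Lemma twisted_derivX q p : twisted_deriv q ('X * p) = 'X * twisted_deriv q p + p.
Proof. by rewrite /twisted_deriv !derivE; ring. Qed.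

(** Iterates D∂ - ∂D = 1. At n = 0 the index [n.-1] is harmless, its multiplicity being 0. *)
Lemma iter_twisted_derivX q n p :
  iter n (twisted_deriv q) ('X * p)
  = 'X * iter n (twisted_deriv q) p + iter n.-1 (twisted_deriv q) p *+ n.
Proof.
elim: n => [|n IHn] /=; first by rewrite mulr0n addr0.
rewrite IHn linearD linearMn /= twisted_derivX mulrS -addrA.
by case: n {IHn}.
Qed.

Lemma twisted_shift0 q p : twisted_shift q 0 p = p.
Proof. by rewrite /twisted_shift invr1 scale1r. Qed.

Hypothesis char0 : has_pchar0 F.

Lemma natr_neq0 n : n.+1%:R != 0 :> F.
Proof. by have /pcharf0P -> := char0. Qed.

Lemma twisted_shiftS q n p :
  twisted_shift q n.+1 p *+ n.+1 = twisted_deriv q (twisted_shift q n p).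
Proof.
rewrite /twisted_shift /= linearZ -scaler_nat scalerA factS natrM invfM mulrA.
by rewrite divff ?natr_neq0 // mul1r.
Qed.

Lemma twisted_shiftX q n p :
  twisted_shift q n ('X * p)
  = 'X * twisted_shift q n p + mul_lambda (twisted_shift q ^~ p) n.
Proof.
rewrite /twisted_shift iter_twisted_derivX scalerDr scalerAr; congr (_ + _).
case: n => [|n] /=; first by rewrite mulr0n scaler0.
by rewrite -scaler_nat scalerA factS natrM invfM mulrAC mulVf ?mul1r ?natr_neq0.
Qed.

(** From 1/(m! n!) = C(m+n,m)/(m+n)!; this is e^{λD} e^{μD} = e^{(λ+μ)D}. *)
Lemma twisted_shift_comp q m n p :
  twisted_shift q m (twisted_shift q n p)
  = at_lambda_plus_mu (twisted_shift q ^~ p) m n.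
Proof.
rewrite [twisted_shift q n p]/twisted_shift linearZ /at_lambda_plus_mu /twisted_shift /=.
rewrite scalerA -iterD -scaler_nat scalerA; congr (_ *: _).
have := bin_fact (leq_addr n m); rewrite addKn => /(congr1 (fun k => k%:R : F)).
rewrite !natrM => <-; rewrite !invfM.
have C0 : 'C(m + n, m)%:R != 0 :> F.
  by rewrite -(prednK (_ : 0 < 'C(m + n, m))%N) ?natr_neq0 // bin_gt0 leq_addr.
by rewrite (mulVKf C0) mulrC.
Qed.

Variables (a b : F) (q : {poly F}).

(* (∂ + b + aλ) e^{λD} p *)
Definition poly_action p n :=
  ('X + b%:P) * twisted_shift q n p + a *: mul_lambda (twisted_shift q ^~ p) n.

Lemma poly_action_is_linear n : linear (poly_action ^~ n).
Proof.
move=> c p r; rewrite /poly_action.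
by case: n => [|n] /=; rewrite !linearP /= -!mul_polyC; ring.
Qed.

Lemma poly_actionX p n :
  poly_action ('X * p) n = 'X * poly_action p n + mul_lambda (poly_action p) n.
Proof.
rewrite /poly_action.
by case: n => [|[|n]] /=; rewrite !twisted_shiftX -?mul_polyC /=; ring.
Qed.

(** Moving e^{λD} past ∂ turns ∂ into ∂+λ, and the two exponentials merge into e^{(λ+μ)D}. *)
Lemma twisted_shift_poly_action p m n :
  twisted_shift q m (poly_action p n) =
  let g := at_lambda_plus_mu (twisted_shift q ^~ p) in
  ('X + b%:P) * g m n + mul_lambda2 g m n + a *: mul_mu2 g m n.
Proof.
rewrite /poly_action /= mulrDl mul_polyC !linearD /= [twisted_shift q m (b *: _)]linearZ.
rewrite [twisted_shift q m (a *: _)]linearZ /= twisted_shiftX.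
by case: m n => [|m] [|n] /=; rewrite ?linear0 ?twisted_shift_comp -!mul_polyC; ring.
Qed.

(** Both products are multiples of e^{(λ+μ)D}, and with x = ∂+b one has (x+aλ)(x+λ+aμ) -
    (x+aμ)(x+μ+aλ) = (λ-μ)(x+a(λ+μ)). *)
Lemma poly_action_commutator p m n :
  poly_action (poly_action p n) m - poly_action (poly_action p m) n
  = mul_lambda2 (at_lambda_plus_mu (poly_action p)) m n
    - mul_mu2 (at_lambda_plus_mu (poly_action p)) m n.
Proof.
pose g := at_lambda_plus_mu (twisted_shift q ^~ p).
have gC i j : g i j = g j i by apply: at_lambda_plus_muC.
have actE i j : at_lambda_plus_mu (poly_action p) i j
    = ('X + b%:P) * g i j + a *: (mul_lambda2 g i j + mul_mu2 g i j).
  rewrite -at_lambda_plus_mu_mul_lambda /g /at_lambda_plus_mu /poly_action.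
  by rewrite mulrnDl -scalerMnr mulrnAr.
rewrite /(poly_action (poly_action p n)) /(poly_action (poly_action p m)).
(* The cases isolate the low coefficients, where a shift by λ or μ gives 0; [gC] brings symmetric
   entries of [g] to a common form for [ring]. *)
case: m n => [|m] [|n] /=; rewrite !twisted_shift_poly_action ?actE /= -/g -!mul_polyC.
- ring.
- by rewrite (gC n.+1 0) (gC n 0); case: n => [|n] /=; rewrite ?(gC n 0); ring.
- by rewrite (gC m.+1 0) (gC m 0); case: m => [|m] /=; rewrite ?(gC m 0); ring.
rewrite (gC n.+1 m.+1) (gC n.+1 m) (gC n m.+1) (gC n m).
by case: m n => [|m] [|n] /=; rewrite ?(gC n 1) ?(gC n m.+2); ring.
Qed.

End TwistedDerivation.

(** * The series e^{q(λ+∂)-q(∂)} as e^{λD} 1 *)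

Section Exponential.

Variable F : fieldType.
Hypothesis char0 : has_pchar0 F.
Implicit Types (p q : {poly F}) (P Q : {poly {poly F}}).

(* ∂/∂λ - ∂/∂∂, which annihilates q(λ+∂) *)
Definition antidiag_deriv P := P^`() - map_poly (@deriv F) P.

Lemma coef_antidiag_deriv P n :
  (antidiag_deriv P)`_n = P`_n.+1 *+ n.+1 - (P`_n)^`().
Proof. by rewrite coefB coef_deriv coef_map_id0 ?deriv0. Qed.

Lemma antidiag_deriv_is_additive : additive antidiag_deriv.
Proof.
move=> P Q; apply/polyP => n.
by rewrite coef_antidiag_deriv [RHS]coefB !coef_antidiag_deriv !coefB derivB; ring.
Qed.

HB.instance Definition _ := GRing.isAdditive.Build {poly {poly F}} {poly {poly F}}
  antidiag_deriv antidiag_deriv_is_additive.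

Lemma antidiag_derivM P Q :
  antidiag_deriv (P * Q) = antidiag_deriv P * Q + P * antidiag_deriv Q.
Proof.
have mapM : map_poly (@deriv F) (P * Q)
    = map_poly (@deriv F) P * Q + P * map_poly (@deriv F) Q.
  apply/polyP => n; rewrite coefD !coefM coef_map_id0 ?deriv0 // coefM.
  rewrite raddf_sum -big_split; apply: eq_bigr => i _ /=.
  by rewrite derivM !coef_map_id0 ?deriv0.
by rewrite /antidiag_deriv derivM mapM; ring.
Qed.

Lemma antidiag_derivC p : antidiag_deriv p%:P = - (p^`())%:P.
Proof. by rewrite /antidiag_deriv derivC map_polyC sub0r. Qed.

Lemma antidiag_derivXn P n :
  antidiag_deriv (P ^+ n.+1) = antidiag_deriv P * P ^+ n *+ n.+1.
Proof.
elim: n => [|n IHn]; first by rewrite expr1 expr0 mulr1.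
by rewrite exprS antidiag_derivM IHn exprS; ring.
Qed.

(* p(λ+∂), in the conventions of [shift_diff] *)
Definition taylor p := p^:P \Po ('X + 'X%:P).

Lemma taylorC c : taylor c%:P = c%:P%:P.
Proof. by rewrite /taylor map_polyC comp_polyC. Qed.

Lemma taylorD p q : taylor (p + q) = taylor p + taylor q.
Proof. by rewrite /taylor rmorphD comp_polyD. Qed.

Lemma taylorMX p : taylor ('X * p) = ('X + 'X%:P) * taylor p.
Proof. by rewrite /taylor rmorphM /= map_polyX comp_polyM comp_polyX. Qed.

(** A derivation that kills λ+∂ and the scalars kills every polynomial in λ+∂. *)
Lemma antidiag_deriv_taylor p : antidiag_deriv (taylor p) = 0.
Proof.
elim/poly_ind: p => [|p c IHp]; first by rewrite taylorC raddf0.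
rewrite mulrC taylorD raddfD /= taylorMX taylorC antidiag_derivM IHp mulr0 addr0.
rewrite raddfD /= !antidiag_derivC derivC derivX oppr0 addr0.
suff -> : antidiag_deriv 'X = 1 by rewrite subrr mul0r.
apply/polyP => n; rewrite coef_antidiag_deriv coef1 !coefX eqSS.
by case: n => [|[|n]]; rewrite /= ?deriv0 ?derivC ?subr0 ?mul0rn.
Qed.

(** For P = q(λ+∂)-q(∂), the derivation ∂/∂λ - ∂/∂∂ sends P to q'(∂), hence e^P to q'(∂) e^P; that
    is, ∂/∂λ e^P = D e^P. *)
Lemma exp_coef_ode q n :
  exp_coef (shift_diff q) n.+1 *+ n.+1
  = twisted_deriv q (exp_coef (shift_diff q) n).
Proof.
set P := shift_diff q.
have DP : antidiag_deriv P = (q^`())%:P.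
  by rewrite raddfB /= -/(taylor q) antidiag_deriv_taylor antidiag_derivC sub0r opprK.
have P0 : P`_0 = 0 by apply: shift_diff_coef0.
apply/eqP; rewrite -subr_eq0 opprD addrA subr_eq0; apply/eqP.
(* A zero term k = n+1 is added for λ^n, to match the range of the sum for λ^(n+1). *)
rewrite -{1}(@exp_coefE _ P n n.+2) // raddf_sum /= /exp_coef -sumrMnl -sumrB.
rewrite big_ord_recl /= [X in X + _ = _](_ : _ = 0) ?add0r; last first.
  rewrite /exp_term !expr0 !coef1.
  by case: n => [|n] /=; rewrite ?scaler0 ?derivZ ?derivC ?scaler0 ?mul0rn subrr.
rewrite mulr_sumr; apply: eq_bigr => i _; rewrite /exp_term /bump leq0n add1n derivZ.
rewrite scalerMnr -scalerBr -coef_antidiag_deriv antidiag_derivXn DP coefMn coefCM.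
rewrite -scaler_nat scalerA factS natrM invfM mulrC mulVKf ?scalerAr //.
exact: natr_neq0.
Qed.

Lemma poly_mulrSnI n : injective (fun p => p *+ n.+1).
Proof.
by move=> p r; rewrite -!scaler_nat; apply: scalerI; apply: natr_neq0.
Qed.

(** Both sides solve ∂E/∂λ = D E with E = 1 at λ = 0. *)
Lemma twisted_shift_exp q n : twisted_shift q n 1 = exp_coef (shift_diff q) n.
Proof.
elim: n => [|n IHn].
  by rewrite twisted_shift0 /exp_coef big_ord1 /exp_term invr1 scale1r coef1.
by apply: (@poly_mulrSnI n); rewrite exp_coef_ode -IHn -twisted_shiftS.
Qed.

(** As ∂+aλ+b has degree at most 1 in λ, only i = n and i = n-1 contribute to the convolution. *)
Lemma rank_one_coefE q a b n : rank_one_coef q a b n = poly_action a b q 1 n.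
Proof.
rewrite /rank_one_coef /poly_action big_ord_recr /= subnn.
rewrite !coefD coefC coefCM coefX /= mulr0 !addr0 coefC /=.
rewrite addrC -twisted_shift_exp mulrC; congr (_ + _).
case: n => [|n]; first by rewrite big_ord0 scaler0.
rewrite big_ord_recr /= subSnn !coefD !coefC coefCM coefX /= big1 => [|i _].
  by rewrite !add0r addr0 mulr1 -twisted_shift_exp mulrC mul_polyC.
rewrite subSn ?(ltnW (ltn_ord i)) //.
have : (0 < n - i)%N by rewrite subn_gt0.
by case: (n - i)%N => // k _; rewrite !coefD !coefC coefCM coefX /= mulr0 !addr0 mulr0.
Qed.

End Exponential.

(** * Solving the commutator identity *)

Section Uniqueness.

Variable F : fieldType.
Hypothesis char0 : has_pchar0 F.
Implicit Types (p q : {poly F}) (f g : nat -> {poly F}).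

(* Coefficient of λ^n in p(λ+∂) f(λ). *)
Definition taylor_conv p f n := \sum_(i < n.+1) (taylor p)`_i * f (n - i)%N.

Lemma taylor_coef0 p : (taylor p)`_0 = p.
Proof.
elim/poly_ind: p => [|p c IHp]; first by rewrite taylorC coef0.
rewrite mulrC taylorD taylorMX taylorC mulrDl !coefD coefXM coefCM coefC IHp /=.
by rewrite add0r.
Qed.

Lemma taylor_coef1 p : (taylor p)`_1 = p^`().
Proof.
elim/poly_ind: p => [|p c IHp]; first by rewrite taylorC coef0 deriv0.
rewrite derivMXaddC mulrC taylorD taylorMX taylorC mulrDl !coefD coefXM coefCM coefC.
by rewrite IHp /= taylor_coef0 addr0 mulrC.
Qed.

Lemma lead_coef_taylor p : lead_coef (taylor p) = (lead_coef p)%:P.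
Proof.
rewrite lead_coef_comp ?size_XaddC // lead_coefXaddC expr1n mulr1.
by rewrite lead_coef_map_inj //; apply: polyC_inj.
Qed.

Lemma taylor_conv0 p f : taylor_conv p f 0 = p * f 0.
Proof. by rewrite /taylor_conv big_ord1 taylor_coef0. Qed.

Lemma taylor_conv1 p f : taylor_conv p f 1 = p * f 1 + p^`() * f 0.
Proof. by rewrite /taylor_conv !big_ord_recl big_ord0 addr0 taylor_coef0 taylor_coef1. Qed.

(** The commutator axiom at a generator v with L_λ v = Σ f_n λ^n v, where L_λ(p v) = p(λ+∂) L_λ
    v. *)
Definition commutator_rel f := forall m n : nat,
  taylor_conv (f n) f m - taylor_conv (f m) f n
  = mul_lambda2 (at_lambda_plus_mu f) m n - mul_mu2 (at_lambda_plus_mu f) m n.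

(** If d had degree e and leading coefficient c, the degree e coefficient on the left would be
    (e+k+1)c, nonzero in characteristic 0. *)
Lemma poly_euler_eq0 (d : {poly F}) b k :
  d^`() * ('X + b%:P) + d *+ k.+1 = 0 -> d = 0.
Proof.
move=> /(congr1 (fun p : {poly F} => p`_(size d).-1)) /eqP.
rewrite mulrDr !coefD coefMC coefMn coefMX coef0 !coef_deriv.
rewrite [d`_(size d).-1.+1]nth_default ?leqSpred // mul0rn mul0r addr0.
have -> : (if (size d).-1 == 0 then 0 else d`_(size d).-1.-1.+1 *+ (size d).-1.-1.+1)
    = d`_(size d).-1 *+ (size d).-1 by case: (size d).-1.
rewrite -mulrnDr addnS -mulr_natr mulf_eq0 (negPf (natr_neq0 char0 _)) orbF.
by rewrite lead_coef_eq0 => /eqP.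
Qed.

Lemma commutator_rel_unique f g b :
  commutator_rel f -> commutator_rel g ->
  f 0 = 'X + b%:P -> f 0 = g 0 -> f 1 = g 1 -> f =1 g.
Proof.
move=> fC gC f0 fg0 fg1 n.
elim/ltn_ind: n => [[|[|n]]] // IHn.
apply/eqP; rewrite -subr_eq0; apply/eqP.
apply: (@poly_euler_eq0 _ b n).
(* The λ^(n+2) μ^1 part: h_1 h_(n+2) cancels, the binomials leave (n+2) - 1, and the sum involves
   only h_0, ..., h_(n+1), known by induction. *)
have step h : commutator_rel h -> \sum_(i < n.+2) (taylor (h 1))`_i.+1 * h (n.+1 - i)%N
    = (h n.+2)^`() * h 0 + h n.+2 *+ n.+1.
  move=> /(_ n.+2 1); rewrite taylor_conv1 /taylor_conv big_ord_recl subn0 taylor_coef0.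
  rewrite /= /at_lambda_plus_mu addn1 addn0 binn binSn mulr1n.
  under eq_bigr do rewrite /bump leq0n add1n subSS.
  set S := \sum_(i < _) _ => hC.
  have -> : S = h 1 * h n.+2 + S - (h n.+2 * h 1 + (h n.+2)^`() * h 0)
      + (h n.+2)^`() * h 0 by ring.
  by rewrite hC; ring.
have := step _ fC; under eq_bigr => i _.
  rewrite fg1 IHn ?ltnS ?leq_subr //; over.
rewrite (step _ gC) -fg0 f0 derivB => /esym fgE.
by rewrite mulrBl mulrnBl addrACA fgE -opprD subrr.
Qed.

Lemma commutator_rel_deriv f : commutator_rel f -> (f 0)^`() * f 0 = f 0.
Proof.
move=> /(_ 1 0); rewrite taylor_conv1 taylor_conv0 /= subr0.
by rewrite /at_lambda_plus_mu bin0 mulr1n addn0 => E; rewrite -[RHS]E; ring.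
Qed.

(** With f_0 = 0, the left side of the λ^(n+1) μ^0 part vanishes and the right side is f_n. *)
Lemma commutator_rel_eq0 f : commutator_rel f -> f 0 = 0 -> f =1 fun=> 0.
Proof.
move=> fC f0 n; move: (fC n.+1 0); rewrite taylor_conv0 f0 mulr0 /= !subr0.
rewrite /at_lambda_plus_mu addn0 binn mulr1n => <-.
by rewrite /taylor_conv big1 // => i _; rewrite taylorC coef0 mul0r.
Qed.

Lemma deriv_eq0 p : p^`() = 0 -> p = (p`_0)%:P.
Proof.
move=> dp0; apply/polyP => [[|n]]; rewrite coefC //=.
have /eqP := congr1 (fun r : {poly F} => r`_n) dp0.
by rewrite coef_deriv coef0 -mulr_natr mulf_eq0 (negPf (natr_neq0 char0 n)) orbF => /eqP.
Qed.

Lemma deriv_surj p : exists q, q^`() = p.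
Proof.
(* Division by 0 at i = 0 makes the constant term 0. *)
exists (\poly_(i < (size p).+1) (p`_i.-1 / i%:R)).
apply/polyP => n; rewrite coef_deriv coef_poly ltnS.
case: ltnP => [ltnp|/(nth_default 0) -> /=]; last by rewrite mul0rn.
by rewrite -[LHS]mulr_natr divfK ?natr_neq0.
Qed.

Lemma commutator_rel_classification f :
  (forall q a b, commutator_rel (rank_one_coef q a b)) ->
  commutator_rel f -> f 0 <> 0 -> exists q a b, f =1 rank_one_coef q a b.
Proof.
move=> rank_oneC fC /eqP f0_neq0.
have df0 : (f 0)^`() = 1 by apply: (mulIf f0_neq0); rewrite commutator_rel_deriv ?mul1r.
have [b f0] : exists b, f 0 = 'X + b%:P.
  have /deriv_eq0 f0C : (f 0 - 'X)^`() = 0 by rewrite derivB derivX df0 subrr.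
  by exists (f 0 - 'X)`_0; rewrite -f0C addrC subrK.
(* Division of f_1 by ∂+b: [a] is the remainder, and the quotient [r] is integrated to give q. *)
pose a := (f 1).[- b].
have /factor_theorem [r f1] : root (f 1 - a%:P) (- b).
  by rewrite /root !hornerE subrr.
have [q dq] := deriv_surj r.
exists q, a, b; apply: (commutator_rel_unique fC (rank_oneC q a b) f0).
  by rewrite rank_one_coefE // /poly_action twisted_shift0 /= mulr1 scaler0 addr0.
rewrite rank_one_coefE // /poly_action /= twisted_shift0.
rewrite /twisted_shift /= invr1 scale1r /twisted_deriv derivC add0r mulr1 dq.
by rewrite alg_polyC mulrC -[b%:P]opprK -polyCN -f1 subrK.
Qed.

End Uniqueness.

(** * Modules on a free generator: existence and classification *)

Section RankOneModule.

Variable F : fieldType.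
Hypothesis char0 : has_pchar0 F.
Variables (V : lmodType {poly F}) (v : V).
Hypothesis v_free : free_on v.
Implicit Types (p q : {poly F}) (L : V -> nat -> V).

Lemma free_onI p q : p *: v = q *: v -> p = q.
Proof. by have [r [_ rU]] := v_free (p *: v) => pq; rewrite -(rU p) // -(rU q). Qed.

(** Sesquilinearity replaces each factor ∂ by ∂+λ, so the action is determined by its value on
    [v]. *)
Lemma gcm_generator L : gen_conformal_module L -> forall p n,
  L (p *: v) n = \sum_(i < n.+1) (taylor p)`_i *: L v (n - i)%N.
Proof.
case=> Llin LX _ p n.
have L0 k : L 0 k = 0.
  have := Llin 1 0 0 k; rewrite scaler0 scale1r addr0 => /esym/(canRL (addrK _)) ->.
  by rewrite subrr.
elim/poly_ind: p n => [|p c IHp] n.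
  by rewrite scale0r L0 big1 // => i _; rewrite taylorC coef0 scale0r.
rewrite addrC mulrC scalerDl Llin -scalerA LX taylorD taylorC taylorMX.
under eq_bigr do rewrite coefD mulrDl coefD coefXM coefCM coefC !scalerDl.
rewrite !big_split /= ['X *: _ + _]addrC; congr (_ + (_ + _)).
- rewrite big_ord_recl /= subn0 big1 ?addr0 // => i _.
  by rewrite scale0r.
- rewrite big_ord_recl scale0r add0r; case: n => [|n] /=; first by rewrite big_ord0.
  by rewrite IHp; apply: eq_bigr.
by rewrite IHp scaler_sumr; apply: eq_bigr => i _; rewrite scalerA.
Qed.

Lemma gcm_commutator_rel L f : gen_conformal_module L ->
  (forall n, L v n = f n *: v) -> commutator_rel f.
Proof.
move=> Lmod Lv m n; apply: free_onI.
have convE p k : L (p *: v) k = taylor_conv p f k *: v.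
  rewrite gcm_generator // /taylor_conv scaler_suml.
  by apply: eq_bigr => i _; rewrite Lv scalerA.
have [_ _ /(_ v m n)] := Lmod; rewrite !Lv !convE scalerBl => ->.
rewrite scalerBl /at_lambda_plus_mu.
by case: m n => [|m] [|n] /=; rewrite ?Lv ?scale0r ?scalerMnl.
Qed.

(** Equality in V is decidable, so [xchoose] turns the existence given by freeness into a
    function. *)
Definition coordinate (u : V) : {poly F} :=
  xchoose (let: ex_intro p (conj up _) := v_free u in
           ex_intro (fun p => u == p *: v) p (introT eqP up)).

Lemma coordinateK u : coordinate u *: v = u.
Proof. by rewrite /coordinate; set E := (X in xchoose X); apply/esym/eqP/(xchooseP E). Qed.

Lemma scaleK p : coordinate (p *: v) = p.
Proof. by apply: free_onI; rewrite coordinateK. Qed.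

Lemma coordinateZD p u w :
  coordinate (p *: u + w) = p * coordinate u + coordinate w.
Proof. by apply: free_onI; rewrite scalerDl -scalerA !coordinateK. Qed.

Definition rank_one_action q a b (u : V) n := poly_action a b q (coordinate u) n *: v.

Lemma rank_one_action_gcm q a b : gen_conformal_module (rank_one_action q a b).
Proof.
split=> [c u w n|u n|u m n]; rewrite /rank_one_action.
- by rewrite coordinateZD mul_polyC poly_action_is_linear scalerDl -mul_polyC scalerA.
- rewrite -[_ *: u]addr0 coordinateZD -[0](scale0r v) scaleK addr0 poly_actionX //.
  by rewrite scalerDl scalerA; case: n => [|n] //=; rewrite scale0r.
rewrite !scaleK -scalerBl poly_action_commutator // scalerBl /at_lambda_plus_mu.
by case: m n => [|m] [|n] /=; rewrite ?scale0r ?scalerMnl.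
Qed.

Lemma rank_one_action_is_M q a b : is_M v q a b (rank_one_action q a b).
Proof.
split=> [|n]; first exact: rank_one_action_gcm.
by rewrite /rank_one_action -[v in coordinate v]scale1r scaleK rank_one_coefE.
Qed.

Lemma is_M_classification L : gen_conformal_module L -> nontrivial_action L ->
  exists q a b, is_M v q a b L.
Proof.
move=> Lmod [u [n Lun]].
have Lv k : L v k = coordinate (L v k) *: v by rewrite coordinateK.
have fC := gcm_commutator_rel Lmod Lv.
(* Read off from the module M_{q,a,b} on V instead of computed. *)
have rank_oneC q a b : commutator_rel (rank_one_coef q a b).
  by have [] := rank_one_action_is_M q a b; apply: gcm_commutator_rel.
case: (eqVneq (coordinate (L v 0)) 0) => [f0|/eqP f0].
  case: Lun; rewrite -(coordinateK u) gcm_generator // big1 // => i _.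
  by rewrite Lv (commutator_rel_eq0 fC f0) scale0r scaler0.
have [q [a [b fE]]] := commutator_rel_classification char0 rank_oneC fC f0.
by exists q, a, b; split=> // k; rewrite Lv fE.
Qed.

(** * Irreducibility *)

Lemma csub_sum L (W : V -> Prop) I (r : seq I) (u : I -> V) :
  conformal_submodule L W -> (forall i, W (u i)) -> W (\sum_(i <- r) u i).
Proof.
case=> W0 WZD _ Wu; elim: r => [|i r IHr]; first by rewrite big_nil.
by rewrite big_cons -[u i]scale1r; apply: WZD.
Qed.

(* The last factor is ∂ + aλ + b, so that this product is e^{q(∂)-q(λ+∂)} L_λ(p v). *)
Definition untwisted_action a b p : {poly {poly F}} :=
  taylor p * ('X%:P + a%:P%:P * 'X + b%:P%:P).

Lemma is_M_untwisted q a b L p n : is_M v q a b L ->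
  L (p *: v) n = \sum_(i < n.+1)
    (exp_coef (shift_diff q) i * (untwisted_action a b p)`_(n - i)) *: v.
Proof.
case=> Lmod Lv; rewrite gcm_generator // -scaler_suml.
(* Truncating the exponential after λ^n makes it a polynomial in λ, so that products can be
   reassociated. *)
pose E := \poly_(i < n.+1) exp_coef (shift_diff q) i.
have EC (P : {poly {poly F}}) k : (k <= n)%N ->
    \sum_(i < k.+1) exp_coef (shift_diff q) i * P`_(k - i) = (E * P)`_k.
  move=> lekn; rewrite coefM; apply: eq_bigr => i _.
  by rewrite coef_poly (leq_trans (ltn_ord i)).
rewrite EC // mulrCA coefM scaler_suml; apply: eq_bigr => i _.
by rewrite Lv scalerA /rank_one_coef EC ?leq_subr.
Qed.

Lemma conformal_submodule_full q a b L W p :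
  is_M v q a b L -> a <> 0 -> conformal_submodule L W -> W (p *: v) -> p != 0 ->
  forall u, W u.
Proof.
move=> LM /eqP a0 Wsub Wp p0; have [W0 WZD WL] := Wsub.
have WZ r u : W u -> W (r *: u) by move=> Wu; rewrite -[_ *: u]addr0; apply: WZD.
(* The exponential has constant term 1, so the n-th coefficient is that of L_λ(p v) minus multiples
   of earlier ones. *)
have WG n : W ((untwisted_action a b p)`_n *: v).
  elim/ltn_ind: n => n IHn; have := WL _ n Wp.
  rewrite (is_M_untwisted _ _ LM) big_ord_recl subn0.
  rewrite /exp_coef big_ord1 /exp_term invr1 scale1r coef1 mul1r.
  set S := \sum_(i < n) _ => WGS; rewrite -[X in W X](addrK S) addrC -scaleN1r.
  apply: WZD => //; apply: (csub_sum _ Wsub) => i.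
  by rewrite -scalerA; apply/WZ/IHn; rewrite lift0 subnSK ?leq_subr.
(* The top coefficient in λ is a nonzero scalar, hence invertible in F[∂]. *)
have lc : lead_coef (untwisted_action a b p) = (lead_coef p * a)%:P.
  rewrite lead_coefM lead_coef_taylor polyCM addrAC addrC -polyCD; congr (_ * _).
  rewrite lead_coefDl ?lead_coefMX ?lead_coefC //.
  by rewrite size_mulX ?polyC_eq0 // !size_polyC !polyC_eq0 a0; case: eqP.
move=> u; rewrite -(coordinateK u); apply: (WZ).
have := WG (size (untwisted_action a b p)).-1; rewrite -lead_coefE lc.
move/(WZ ((lead_coef p * a)^-1)%:P); rewrite scalerA -polyCM mulVf ?scale1r //.
by rewrite mulf_neq0 ?lead_coef_eq0.
Qed.

Lemma generator_neq0 : v != 0.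
Proof.
apply/eqP => v0; have /eqP : (1 : {poly F}) = 0 by apply: free_onI; rewrite v0 !scaler0.
by rewrite oner_eq0.
Qed.

Lemma is_M_irreducible q a b L :
  is_M v q a b L -> (conformal_irreducible L <-> a <> 0).
Proof.
move=> LM; split=> [[_ irr] a0|a0]; last first.
  split=> [|W Wsub]; first by exists v; apply/eqP/generator_neq0.
  have [[u [Wu /eqP u0]]|Wtriv] := pselect (exists u, W u /\ u <> 0).
    right; apply: (conformal_submodule_full LM a0 Wsub (p := coordinate u)).
      by rewrite coordinateK.
    by apply: contra u0 => /eqP u0; rewrite -(coordinateK u) u0 scale0r.
  left=> u; split=> [Wu|->]; last by case: Wsub.
  by apply: contrapT => u0; apply: Wtriv; exists u.
(* Both actions agree on [v], hence everywhere. *)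
have Lact u n : L u n = rank_one_action q a b u n.
  rewrite -(coordinateK u); have [Lmod Lv] := LM.
  have [Rmod Rv] := rank_one_action_is_M q a b.
  by rewrite !gcm_generator //; apply: eq_bigr => i _; rewrite Lv Rv.
(* For a = 0 every [L u n] is a multiple of ∂+b, so (∂+b)V is a submodule. *)
pose W u := exists p, u = (('X + b%:P) * p) *: v.
have Wsub : conformal_submodule L W.
  split=> [|p u w [r ->] [s ->]|u n _].
  - by exists 0; rewrite mulr0 scale0r.
  - by exists (p * r + s); rewrite mulrDr scalerDl mulrCA scalerA.
  by rewrite Lact /rank_one_action /poly_action a0 scale0r addr0; eexists.
(* It is nonzero because ∂+b is, and it misses [v]: evaluating 1 = (∂+b)p at ∂ = -b gives 1 = 0. *)
have [Wtriv|/(_ v) [p]] := irr W Wsub.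
  have /Wtriv : W (('X + b%:P) *: v) by exists 1; rewrite mulr1.
  rewrite -(scale0r v) => /free_onI /eqP.
  by rewrite -size_poly_eq0 size_XaddC.
rewrite -{1}[v]scale1r => /free_onI /(congr1 (fun r : {poly F} => r.[- b])) /eqP.
by rewrite !hornerE addNr mul0r oner_eq0.
Qed.

End RankOneModule.

Theorem theorem3p11 (R : realType) (V : lmodType {poly R[i]}) (v : V)
  (v_free : free_on v) :
  (forall L : V -> nat -> V,
     gen_conformal_module L -> nontrivial_action L ->
     exists (q : {poly R[i]}) (a b : R[i]), is_M v q a b L)
  /\
  (forall (q : {poly R[i]}) (a b : R[i]),
     (exists L : V -> nat -> V, is_M v q a b L) /\
     (forall L : V -> nat -> V, is_M v q a b L ->
        (conformal_irreducible L <-> a <> 0))).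
Proof.
have char0 : has_pchar0 R[i] by apply: Num.Theory.pchar_num.
split=> [L|q a b]; first exact: is_M_classification.
split=> [|L]; last exact: is_M_irreducible.
by exists (rank_one_action v_free q a b); apply: rank_one_action_is_M.
Qed.
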